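(* Let $\mathcal{I}$ denote the class of impartial scoring play games, and let $\approx$ be the equivalence on $\mathcal{I}$ given by $G\approx H$ iff $G+_{\ell}X$ and $H+_{\ell}X$ lie in the same outcome class for every $X\in\mathcal{I}$. Then $\mathcal{I}$ (up to $\approx$) forms a commutative monoid under the disjunctive sum $+_{\ell}$, and this monoid is non-trivial in the sense that the set $$I=\{\, i\in\mathcal{I} : G+_{\ell} i\approx G \text{ for all } G\in\mathcal{I}\,\}$$ of identity elements contains more than one element (for instance, both $\{.\,|0|\,.\}$ and $\{\{0|0|0\}\,|\,0\,|\,\{0|0|0\}\}$ belong to $I$).
   Context: A scoring play game is written $G=\{G^L|G^S|G^R\}$, where $G^L$ and $G^R$ are (finite) sets of scoring play games (the Left and Right options) and $G^S\in\mathbb{R}$ is the current score (Left's points minus Right's points); the recursion bottoms out at games with $G^L=G^R=\emptyset$. Every play terminates after finitely many moves. $\{.|r|.\}$ denotes the game with no options and score $r$; for a game $G$ and a real $r$, $G+_{\ell} r$ denotes $G$ with every score in its game tree increased by $r$. The negative $-G$ is obtained by swapping Left and Right options throughout and negating every score. The disjunctive sum is $G+_{\ell} H=\{G^L+_{\ell} H,\,G+_{\ell} H^L\,|\,G^S+H^S\,|\,G^R+_{\ell} H,\,G+_{\ell} H^R\}$, where $G^L+_{\ell}H$ ranges over all Left options of $G$, etc.; the sum ends only when the player to move has no move in any component. The Left final score $G^{SL}_F$ is the score at the terminal position reached when Left moves first and both play perfectly (Left maximizing, Right minimizing the final score); the Right final score $G^{SR}_F$ is defined likewise with Right moving first. Outcome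 classes: with $L_>=\{G: G^{SL}_F>0\}$, $L_<$, $L_=$ and $R_>$, $R_<$, $R_=$ defined analogously via $G^{SL}_F$ and $G^{SR}_F$: $\mathcal{L}=(L_>\cap R_>)\cup(L_>\cap R_=)\cup(L_=\cap R_>)$, $\mathcal{R}=(L_<\cap R_<)\cup(L_<\cap R_=)\cup(L_=\cap R_<)$, $\mathcal{N}=L_>\cap R_<$, $\mathcal{P}=L_<\cap R_>$, and the tie class $L_=\cap R_=$. A scoring game $G$ is impartial if (1) $G^L=\emptyset$ iff $G^R=\emptyset$, and (2) if $G^L\neq\emptyset$ then for every $g^L\in G^L$ there is $g^R\in G^R$ with $g^L+_{\ell}(-G^S)=-(g^R+_{\ell}(-G^S))$.
   Formalization: Impartial is required at every position of the game and condition (2) is taken together with its Left/Right dual; with the root-only, one-sided definition the sum is not closed and {{0|0|0}|0|{0|0|0}} is not an identity. *)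

(* Defs.v *)
From HB Require Import structures.
From mathcomp Require Import all_boot all_order all_algebra.
From mathcomp Require Import reals.

Set Implicit Arguments.
Unset Strict Implicit.
Unset Printing Implicit Defensive.

Import Order.TTheory GRing.Theory Num.Theory.
Local Open Scope ring_scope.

(* [Game GL s GR] is {GL | s | GR}.  Finite sets of options are represented by
   sequences; order and repetitions are quotiented out by [identical]. *)
Inductive game (R : Type) : Type :=
  Game of seq (game R) & R & seq (game R).

Definition lefts (R : Type) (G : game R) : seq (game R) :=
  let: Game GL _ _ := G in GL.

Definition score (R : Type) (G : game R) : R :=
  let: Game _ s _ := G in s.

Definition rights (R : Type) (G : game R) : seq (game R) :=
  let: Game _ _ GR := G in GR.

Definition stop (R : Type) (r : R) : game R := Game [::] r [::].

(* Equality of games when options are sets: hereditary equality of the scores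
   and of the option sets, the latter as mutual inclusion. *)
Fixpoint identical (R : realType) (G H : game R) {struct G} : bool :=
  let: Game GL s GR := G in
  let: Game HL t HR := H in
  [&& s == t,
      all (fun g => has (fun h => identical g h) HL) GL,
      all (fun h => has (fun g => identical g h) GL) HL,
      all (fun g => has (fun h => identical g h) HR) GR &
      all (fun h => has (fun g => identical g h) GR) HR].

Fixpoint shift (R : realType) (G : game R) (r : R) {struct G} : game R :=
  let: Game GL s GR := G in
  Game [seq shift g r | g <- GL] (s + r) [seq shift g r | g <- GR].

Fixpoint neg (R : realType) (G : game R) : game R :=
  let: Game GL s GR := G in
  Game [seq neg g | g <- GR] (- s) [seq neg g | g <- GL].

Fixpoint dsum (R : realType) (G : game R) : game R -> game R :=
  fix dsumG (H : game R) : game R :=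
    let: Game GL s GR := G in
    let: Game HL t HR := H in
    Game ([seq dsum g H | g <- GL] ++ [seq dsumG h | h <- HL])
         (s + t)
         ([seq dsum g H | g <- GR] ++ [seq dsumG h | h <- HR]).

(* Final score under optimal play when Left (resp. Right) moves first; play
   stops as soon as the player to move has no option. *)
Fixpoint left_final (R : realType) (G : game R) : R :=
  let: Game GL s _ := G in
  if [seq right_final g | g <- GL] is x :: xs
  then \big[Num.max/x]_(y <- xs) y else s
with right_final (R : realType) (G : game R) : R :=
  let: Game _ s GR := G in
  if [seq left_final g | g <- GR] is x :: xs
  then \big[Num.min/x]_(y <- xs) y else s.

Variant outcome_class := OutL | OutR | OutN | OutP | OutTie.

Definition in_class (R : realType) (o : outcome_class) (G : game R) : bool :=
  let l := left_final G in
  let r := right_final G in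
  match o with
  | OutL => [|| (0 < l) && (0 < r), (0 < l) && (r == 0) | (l == 0) && (0 < r)]
  | OutR => [|| (l < 0) && (r < 0), (l < 0) && (r == 0) | (l == 0) && (r < 0)]
  | OutN => (0 < l) && (r < 0)
  | OutP => (l < 0) && (0 < r)
  | OutTie => (l == 0) && (r == 0)
  end.

Definition same_outcome (R : realType) (G H : game R) : Prop :=
  exists o : outcome_class, in_class o G /\ in_class o H.

(* g + (- s) = - (h + (- s)). *)
Definition mirrored (R : realType) (s : R) (g h : game R) : bool :=
  identical (shift g (- s)) (neg (shift h (- s))).

(* "For every Left option there is a mirrored Right option" is taken together
   with its Left-Right dual: with only one half, {0 | 0 | 0, -5} would qualify
   and the class would not be closed under sums (add {1 | 0 | -1}). *)
Definition impartial_at (R : realType) (G : game R) : bool :=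
  [&& nilp (lefts G) == nilp (rights G),
      all (fun g => has (fun h => mirrored (score G) g h) (rights G)) (lefts G) &
      all (fun h => has (fun g => mirrored (score G) g h) (lefts G)) (rights G)].

(* Impartiality is required at every position, not only at the root: the root
   condition alone holds of {{10 | 0 | .} | 0 | {. | 0 | -10}}, to which
   [two_moves] below is not neutral. *)
Fixpoint impartial (R : realType) (G : game R) : bool :=
  let: Game GL _ GR := G in
  [&& impartial_at G, all (fun g => impartial g) GL &
      all (fun g => impartial g) GR].

Definition imp_equiv (R : realType) (G H : game R) : Prop :=
  forall X : game R, impartial X -> same_outcome (dsum G X) (dsum H X).

(* The elements of [T] satisfying [P] form a commutative monoid up to [eqv]. *)
Record comm_monoid_upto (T : Type) (P : T -> Prop) (eqv : T -> T -> Prop)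
    (op : T -> T -> T) : Prop := CommMonoidUpto {
  cmu_refl : forall x, P x -> eqv x x;
  cmu_sym : forall x y, P x -> P y -> eqv x y -> eqv y x;
  cmu_trans : forall x y z, P x -> P y -> P z ->
    eqv x y -> eqv y z -> eqv x z;
  cmu_closed : forall x y, P x -> P y -> P (op x y);
  cmu_congr : forall x x' y y', P x -> P x' -> P y -> P y' ->
    eqv x x' -> eqv y y' -> eqv (op x y) (op x' y');
  cmu_assoc : forall x y z, P x -> P y -> P z ->
    eqv (op x (op y z)) (op (op x y) z);
  cmu_comm : forall x y, P x -> P y -> eqv (op x y) (op y x);
  cmu_unit : exists e, P e /\
    forall x, P x -> eqv (op e x) x /\ eqv (op x e) x
}.

Definition identity_elt (R : realType) (i : game R) : Prop :=
  impartial i /\ forall G : game R, impartial G -> imp_equiv (dsum G i) G.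

Definition one_move (R : realType) : game R := Game [:: stop 0] 0 [:: stop 0].

Definition two_moves (R : realType) : game R :=
  Game [:: one_move R] 0 [:: one_move R].

(* Main.v *)
Require Import Defs.
From HB Require Import structures.
From mathcomp Require Import all_boot all_order all_algebra.
From mathcomp Require Import boolp reals.

(** An impartial game is, up to its score, its own negative; since negation and
    shifts distribute over sums, this makes impartial games closed under sums.
    Sums are associative and commutative up to equality of option sets, which
    preserves both final scores.  Adding [two_moves] changes no final score of an
    impartial game: a player answers any move made in [two_moves] by the other
    move there, and a player forced to start it is facing a position where
    neither player has any other move. *)

Import Order.TTheory GRing.Theory Num.Theory.
Local Open Scope ring_scope.

(** Classical equality test, so that membership in an option list makes sense. It decides equality
    of games as trees of lists, which is finer than [identical]. *)
HB.instance Definition _ (R : Type) := gen_eqMixin (game R).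

(* The player to move is encoded by a boolean, [true] standing for Right. *)
Definition options {R : Type} (b : bool) (G : game R) : seq (game R) :=
  if b then rights G else lefts G.

Definition final {R : realType} (b : bool) (G : game R) : R :=
  if b then right_final G else left_final G.

(** The preference order of player [b]: with it, each fact about maxima for Left and minima for
    Right is proved once. *)
Definition no_better {R : realType} (b : bool) (x y : R) : bool :=
  if b then y <= x else x <= y.

(** Since [game] is nested through [seq], its generated induction principle says nothing about the
    members of the option lists. *)
Lemma game_options_ind (R : Type) (P : game R -> Prop) :
  (forall G, (forall b, {in options b G, forall g, P g}) -> P G) ->
  forall G, P G.
Proof.
(* [IH] is cleared before closing a goal automatically, since a call of [IH] on
   anything but a listed option fails the guard condition. *)
move=> step; fix IH 1 => -[GL s GR]; apply: step => -[] /=.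
  elim: GR => [h {IH} | g GR' IHs h]; first by [].
  by rewrite inE => /orP[/eqP-> | {IH}]; [apply: IH | apply: IHs].
elim: GL => [h {IH} | g GL' IHs h]; first by [].
by rewrite inE => /orP[/eqP-> | {IH}]; [apply: IH | apply: IHs].
Qed.

Lemma game_eqP (R : Type) (G H : game R) :
  score G = score H -> (forall b, options b G = options b H) -> G = H.
Proof.
case: G H => [GL s GR] [HL t HR] /= -> eqo.
by rewrite (eqo false : GL = HL) (eqo true : GR = HR).
Qed.

Section Games.
Set Implicit Arguments.
Unset Strict Implicit.
Unset Printing Implicit Defensive.
Variable R : realType.
Implicit Types (G H K X : game R) (b : bool).

(** * Shifts, negatives and sums, up to equality of games *)

Lemma options_shift b G r : options b (shift G r) = [seq shift g r | g <- options b G].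
Proof. by case: G b => ? ? ? []. Qed.

Lemma options_neg b G : options b (neg G) = [seq neg g | g <- options (~~ b) G].
Proof. by case: G b => ? ? ? []. Qed.

Lemma options_dsum b G H :
  options b (dsum G H) =
    [seq dsum g H | g <- options b G] ++ [seq dsum G h | h <- options b H].
Proof. by case: G => ? ? ?; case: H b => ? ? ? []. Qed.

Lemma options_dsuml b G H g : g \in options b G -> dsum g H \in options b (dsum G H).
Proof.
by move=> gin; rewrite options_dsum mem_cat (map_f (fun g => dsum g H) gin).
Qed.

Lemma options_dsumr b G H h : h \in options b H -> dsum G h \in options b (dsum G H).
Proof. by move=> hin; rewrite options_dsum mem_cat (map_f (dsum G) hin) orbT. Qed.

Lemma score_shift G r : score (shift G r) = score G + r.
Proof. by case: G. Qed.

Lemma score_neg G : score (neg G) = - score G.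
Proof. by case: G. Qed.

Lemma score_dsum G H : score (dsum G H) = score G + score H.
Proof. by case: G => ? ? ?; case: H. Qed.

Lemma negK : involutive (@neg R).
Proof.
elim/game_options_ind => G IH; apply: game_eqP => [|b].
  by rewrite !score_neg opprK.
rewrite !options_neg negbK -map_comp -[RHS]map_id.
by apply/eq_in_map => g /IH.
Qed.

Lemma dsum_shift G H r t : dsum (shift G r) (shift H t) = shift (dsum G H) (r + t).
Proof.
elim/game_options_ind: G H => G IHG; elim/game_options_ind => H IHH.
apply: game_eqP => [|b].
  by rewrite score_dsum !score_shift score_dsum addrACA.
rewrite options_dsum !options_shift options_dsum map_cat -!map_comp.
congr (_ ++ _); apply/eq_in_map => g gin /=; first exact: (IHG b).
exact: (IHH b).
Qed.

Lemma neg_dsum G H : neg (dsum G H) = dsum (neg G) (neg H).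
Proof.
elim/game_options_ind: G H => G IHG; elim/game_options_ind => H IHH.
apply: game_eqP => [|b].
  by rewrite score_neg !score_dsum !score_neg opprD.
rewrite options_dsum !options_neg options_dsum map_cat -!map_comp.
congr (_ ++ _); apply/eq_in_map => g gin /=; first exact: (IHG (~~ b)).
exact: (IHH (~~ b)).
Qed.

Lemma dsumA : associative (@dsum R).
Proof.
elim/game_options_ind=> G IHG; elim/game_options_ind=> H IHH.
elim/game_options_ind=> K IHK; apply: game_eqP => [|b].
  by rewrite !score_dsum addrA.
rewrite !options_dsum !map_cat -!map_comp catA.
congr ((_ ++ _) ++ _); apply/eq_in_map => g gin /=; first exact: (IHG b).
  exact: (IHH b).
exact: (IHK b).
Qed.

Lemma dsumr0 G : dsum G (stop 0) = G.
Proof.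
elim/game_options_ind: G => G IH; apply: game_eqP => [|b].
  by rewrite score_dsum addr0.
rewrite options_dsum (_ : options b (stop 0) = [::]) ?cats0; last by case: b.
by rewrite -[RHS]map_id; apply/eq_in_map => g /IH.
Qed.

(** * Equality of option sets as a congruence *)

Lemma identicalP G H :
  identical G H <->
  [/\ score G = score H,
      forall b g, g \in options b G -> exists2 h, h \in options b H & identical g h
    & forall b h, h \in options b H -> exists2 g, g \in options b G & identical g h].
Proof.
case: G H => [GL s GR] [HL t HR] /=; split.
  case/and5P=> /eqP-> /allP GHL /allP HGL /allP GHR /allP HGR.
  by split=> // -[] g /= gin; apply/hasP; auto.
case=> -> GH HG; rewrite eqxx /=.
apply/and4P; split; apply/allP => g gin; apply/hasP.
- exact: (GH false).
- exact: (HG false).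
- exact: (GH true).
- exact: (HG true).
Qed.

Lemma identical_refl : reflexive (@identical R).
Proof.
elim/game_options_ind => G IH; apply/identicalP.
by split=> // b g gin; exists g; rewrite ?(IH b).
Qed.

Lemma identical_sym : symmetric (@identical R).
Proof.
suff sym G H : identical G H -> identical H G by move=> G H; apply/idP/idP; apply: sym.
elim/game_options_ind: G H => G IH H /identicalP[sE GH HG].
apply/identicalP; split=> // b g gin.
  by have [h hin /(IH b _ hin)] := HG b g gin; exists h.
by have [h hin /(IH b _ gin)] := GH b g gin; exists h.
Qed.

Lemma identical_neg G H : identical G H -> identical (neg G) (neg H).
Proof.
elim/game_options_ind: G H => G IH H /identicalP[sE GH HG].
apply/identicalP; rewrite !score_neg sE; split=> // b g.
  rewrite !options_neg => /mapP[g' gin ->].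
  have [h hin gh] := GH _ _ gin.
  by exists (neg h); [apply: map_f | apply: IH gin _ gh].
rewrite !options_neg => /mapP[h hin ->].
have [g' gin gh] := HG _ _ hin.
by exists (neg g'); [apply: map_f | apply: IH gin _ gh].
Qed.

Lemma identical_dsum G G' H H' :
  identical G G' -> identical H H' -> identical (dsum G H) (dsum G' H').
Proof.
elim/game_options_ind: G G' H H' => G IHG G'.
elim/game_options_ind => H IHH H' eG eH.
have [sG GG' G'G] := (identicalP _ _).1 eG.
have [sH HH' H'H] := (identicalP _ _).1 eH.
apply/identicalP; rewrite !score_dsum sG sH; split=> // b k.
  rewrite options_dsum mem_cat => /orP[] /mapP[g gin ->].
    have [g' g'in gg'] := GG' _ _ gin; exists (dsum g' H').
      exact: options_dsuml.
    exact: (IHG b g gin).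
  have [g' g'in gg'] := HH' _ _ gin; exists (dsum G' g').
    exact: options_dsumr.
  exact: (IHH b g gin).
rewrite options_dsum mem_cat => /orP[] /mapP[g gin ->].
  have [g' g'in gg'] := G'G _ _ gin; exists (dsum g' H).
    exact: options_dsuml.
  exact: (IHG b g' g'in).
have [g' g'in gg'] := H'H _ _ gin; exists (dsum G g').
  exact: options_dsumr.
exact: (IHH b g' g'in).
Qed.

(** Swapping the summands permutes the concatenated option lists, so this holds only for option
    sets, whereas [dsumA] keeps the order and is an equality. *)
Lemma dsumC G H : identical (dsum G H) (dsum H G).
Proof.
elim/game_options_ind: G H => G IHG; elim/game_options_ind => H IHH.
apply/identicalP; rewrite !score_dsum addrC; split=> // b k;
  rewrite options_dsum mem_cat => /orP[] /mapP[g gin ->].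
- by exists (dsum H g); [apply: options_dsumr | apply: (IHG b)].
- by exists (dsum g G); [apply: options_dsuml | apply: (IHH b)].
- by exists (dsum G g); [apply: options_dsumr | apply: (IHH b)].
- by exists (dsum g H); [apply: options_dsuml | apply: (IHG b)].
Qed.

Lemma dsumCA G H K : identical (dsum G (dsum H K)) (dsum H (dsum G K)).
Proof. by rewrite !dsumA identical_dsum ?dsumC ?identical_refl. Qed.

(** * Impartial games and their closure under sums *)

Lemma mirrored_sym (s : R) G H : mirrored s G H = mirrored s H G.
Proof.
rewrite /mirrored; apply/idP/idP => /identical_neg;
  by rewrite negK identical_sym.
Qed.

(** Symmetry of [mirrored] lets the two dual matching conditions be stated as one, indexed by the
    player. *)
Lemma impartialP G :
  impartial G <->
  [/\ forall b b', nilp (options b G) = nilp (options b' G),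
      forall b g, g \in options b G ->
        exists2 h, h \in options (~~ b) G & mirrored (score G) g h
    & forall b, {in options b G, forall g, impartial g}].
Proof.
case: G => [GL s GR] /=; rewrite /impartial_at /=; split.
  case/and3P=> /and3P[/eqP nE /allP mL /allP mR] /allP iL /allP iR; split.
  - by move=> [] [] /=.
  - case=> g /= gin; last by apply/hasP; apply: mL.
    by have /hasP[h hin] := mR g gin; rewrite mirrored_sym; exists h.
  - by case.
case=> nE m i; apply/and3P; split; [apply/and3P; split | |].
- by rewrite (nE false true : nilp GL = nilp GR).
- by apply/allP => g gin; apply/hasP; apply: (m false).
- apply/allP => g gin; apply/hasP.
  by have [h hin] := m true g gin; rewrite mirrored_sym; exists h.
- exact/allP/(i false).
- exact/allP/(i true).
Qed.

Lemma mirrored_impartial G : impartial G -> mirrored (score G) G G.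
Proof.
case/impartialP=> _ m _; apply/identicalP.
rewrite score_neg score_shift subrr oppr0; split=> // b k;
  rewrite options_neg !options_shift -map_comp => /mapP[g gin ->].
  have [h hin gh] := m b g gin.
  exists (neg (shift h (- score G))) => //.
  exact: (map_f (fun g => neg (shift g (- score G)))).
have [h] := m _ g gin; rewrite negbK mirrored_sym => hin gh.
by exists (shift h (- score G)) => //; apply: map_f.
Qed.

Lemma mirrored_dsum (s t : R) G G' H H' :
  mirrored s G G' -> mirrored t H H' -> mirrored (s + t) (dsum G H) (dsum G' H').
Proof.
by move=> mG mH; rewrite /mirrored opprD -!dsum_shift neg_dsum identical_dsum.
Qed.

Lemma impartial_dsum G H : impartial G -> impartial H -> impartial (dsum G H).
Proof.
elim/game_options_ind: G H => G IHG; elim/game_options_ind => H IHH iG iH.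
have [nG mG oG] := (impartialP _).1 iG; have [nH mH oH] := (impartialP _).1 iH.
apply/impartialP; split=> [b b'|b k|b k].
- rewrite !options_dsum !/(nilp _) !size_cat !size_map !addn_eq0.
  by congr (_ && _); [apply: nG | apply: nH].
- rewrite options_dsum score_dsum mem_cat => /orP[] /mapP[g gin ->].
    (* The matching option moves in the same component; the untouched component mirrors itself. *)
    have [h hin gh] := mG b g gin; exists (dsum h H).
      exact: options_dsuml.
    by apply: mirrored_dsum; rewrite ?mirrored_impartial.
  have [h hin gh] := mH b g gin; exists (dsum G h).
    exact: options_dsumr.
  by apply: mirrored_dsum; rewrite ?mirrored_impartial.
- rewrite options_dsum mem_cat => /orP[] /mapP[g gin ->].
    by apply: (IHG b) => //; apply: (oG b).
  by apply: (IHH b) => //; apply: (oH b).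
Qed.

Lemma impartial_two_moves : impartial (two_moves R).
Proof. by rewrite /= /impartial_at /= /mirrored /= !subr0 !oppr0 !eqxx. Qed.

(** * Final scores, characterized by their bounds *)

Lemma no_better_refl b (x : R) : no_better b x x.
Proof. by case: b => /=. Qed.

Lemma no_better_trans b (y x z : R) :
  no_better b x y -> no_better b y z -> no_better b x z.
Proof. by case: b => /= xy yz; [apply: le_trans yz xy | apply: le_trans xy yz]. Qed.

Lemma no_better_inj b (x y : R) :
  (forall c, no_better b x c = no_better b y c) -> x = y.
Proof.
move=> xy; have yx : no_better b y x by rewrite -xy no_better_refl.
have : no_better b x y by rewrite xy no_better_refl.
by case: b yx {xy} => /= ? ?; apply/le_anti/andP.
Qed.

(** The universal property of the maximum or minimum. Together with [no_better_inj] it replaces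
    computations with iterated operators by statements about all options, insensitive to order and
    repetition. *)
Lemma final_no_better b G (c : R) :
  no_better b (final b G) c =
    if nilp (options b G) then no_better b (score G) c
    else all (fun g => no_better b (final (~~ b) g) c) (options b G).
Proof.
case: G b => [GL s GR] [] /=.
  case: GR => //= g GR; elim: GR => [|h GR IH] /=; first by rewrite big_nil andbT.
  by rewrite big_cons le_min IH andbCA.
case: GL => //= g GL; elim: GL => [|h GL IH] /=; first by rewrite big_nil andbT.
by rewrite big_cons ge_max IH andbCA.
Qed.

Lemma final_option b G g :
  g \in options b G -> no_better b (final (~~ b) g) (final b G).
Proof.
move=> gin; have := no_better_refl b (final b G).
by rewrite final_no_better; case: nilP gin => [-> //|_ gin /allP]; apply.
Qed.

Lemma identical_final b G H : identical G H -> final b G = final b H.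
Proof.
elim/game_options_ind: G b H => G IH b H /identicalP[sE GH HG].
apply: (@no_better_inj b) => c; rewrite !final_no_better sE.
have -> : nilp (options b G) = nilp (options b H).
  case: (options b G) (options b H) (GH b) (HG b) => [|g s] [|h t] //= GHb HGb.
    by have [] := HGb h (mem_head _ _).
  by have [] := GHb g (mem_head _ _).
case: ifP => // _; apply/allP/allP => le_c k kin.
  by have [g gin gk] := HG b k kin; rewrite -(IH b g gin _ _ gk); apply: le_c.
by have [h hin kh] := GH b k kin; rewrite (IH b k kin _ _ kh); apply: le_c.
Qed.

Lemma final_two_moves b G : impartial G -> final b (dsum G (two_moves R)) = final b G.
Proof.
elim/game_options_ind: G b => G IH b iG.
have [nG _ oG] := (impartialP _).1 iG.
have two_opt b' : options b' (two_moves R) = [:: one_move R] by case: b'.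
have one_opt b' : options b' (one_move R) = [:: stop 0] by case: b'.
apply: (@no_better_inj b) => c.
rewrite final_no_better options_dsum two_opt.
rewrite {1}/nilp size_cat addn1 /= all_cat all_map /= andbT.
rewrite (_ : all _ _ = all (fun g => no_better b (final (~~ b) g) c) (options b G));
  last by apply: eq_in_all => g gin /=; rewrite (IH b) // (oG b).
rewrite [in RHS]final_no_better.
case: nilP => [GE | GN].
  (* By impartiality neither player can move in [G], so both moves of [two_moves] are forced and the
     score stays that of [G]. *)
  rewrite GE /=.
  have -> : final (~~ b) (dsum G (one_move R)) = final b G.
    apply: (@no_better_inj (~~ b)) => d.
    rewrite final_no_better options_dsum one_opt.
    have /nilP-> : nilp (options (~~ b) G) by rewrite (nG _ b) GE.
    by rewrite /= dsumr0 negbK andbT.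
  by rewrite final_no_better GE.
(* The moves in [G] already give the bound of [final b G]; it remains to see that opening
   [two_moves] does not beat it. *)
apply/andb_idr => le_c.
have : no_better b (final b G) c by rewrite final_no_better; case: nilP.
apply: no_better_trans.
(* The opponent may answer in [one_move], giving back [G] with [b] to move. *)
have := @final_option (~~ b) (dsum G (one_move R)) G.
rewrite negbK options_dsum one_opt mem_cat /= dsumr0 mem_head orbT.
by case: b {GN le_c} => /(_ isT).
Qed.

(** * Outcome classes and the induced equivalence *)

Lemma in_class_exists G : exists o, in_class o G.
Proof.
case: (ltgtP (left_final G) 0) => l; case: (ltgtP (right_final G) 0) => r;
  (* The signs run through negative, positive, zero, the left score varying slowest. *)
  [ exists OutR | exists OutP | exists OutR | exists OutN | exists OutL
  | exists OutL | exists OutR | exists OutL | exists OutTie ];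
  by rewrite /= ?l ?r ?eqxx ?ltxx ?orbT.
Qed.

(** Disjointness of the classes is what makes [same_outcome] transitive. *)
Lemma in_class_inj G o o' : in_class o G -> in_class o' G -> o = o'.
Proof.
case: o; case: o' => //=; case: (ltgtP (left_final G) 0) => l //=;
  by case: (ltgtP (right_final G) 0).
Qed.

Lemma same_outcome_sym G H : same_outcome G H -> same_outcome H G.
Proof. by case=> o [oG oH]; exists o. Qed.

Lemma same_outcome_trans H G K :
  same_outcome G H -> same_outcome H K -> same_outcome G K.
Proof.
move=> [o [oG oH]] [o' [o'H o'K]]; exists o; split=> //.
by rewrite (in_class_inj oH o'H).
Qed.

Lemma same_outcome_final G H : (forall b, final b G = final b H) -> same_outcome G H.
Proof.
move=> GH; have [o oG] := in_class_exists G; exists o; split=> //.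
move: oG; rewrite /in_class.
by rewrite (GH false : left_final G = _) (GH true : right_final G = _).
Qed.

Lemma same_outcome_identical G H : identical G H -> same_outcome G H.
Proof. by move=> GH; apply: same_outcome_final => b; apply: identical_final. Qed.

Lemma imp_equiv_identical G H : identical G H -> imp_equiv G H.
Proof.
by move=> GH X _; apply/same_outcome_identical/identical_dsum/identical_refl.
Qed.

(** Replace one summand at a time, absorbing the other into the test game: [dsum H X] and then
    [dsum G' X] are admissible tests by closure under sums. *)
Lemma imp_equiv_dsum G G' H H' : impartial G' -> impartial H ->
  imp_equiv G G' -> imp_equiv H H' -> imp_equiv (dsum G H) (dsum G' H').
Proof.
move=> iG' iH eG eH X iX; rewrite -!dsumA.
apply: same_outcome_trans (eG _ (impartial_dsum iH iX)) _.
apply: same_outcome_trans (same_outcome_identical (dsumCA _ _ _)) _.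
apply: same_outcome_trans (eH _ (impartial_dsum iG' iX)) _.
exact/same_outcome_identical/dsumCA.
Qed.

(** * Identity elements and the monoid *)

Lemma identity_stop0 : identity_elt (stop (0 : R)).
Proof.
split=> // G _; rewrite dsumr0; exact/imp_equiv_identical/identical_refl.
Qed.

Lemma identity_two_moves : identity_elt (two_moves R).
Proof.
split=> [|G iG X iX]; first exact: impartial_two_moves.
apply: same_outcome_final => b.
(* With [two_moves] moved last, it is added to the impartial game [dsum G X]. *)
have /identical_final-> :
    identical (dsum (dsum G (two_moves R)) X) (dsum (dsum G X) (two_moves R)).
  by rewrite -!dsumA identical_dsum ?dsumC ?identical_refl.
by rewrite final_two_moves // impartial_dsum.
Qed.

Lemma impartial_monoid :
  comm_monoid_upto (fun G : game R => impartial G) (@imp_equiv R) (@dsum R).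
Proof.
split.
- by move=> G _; apply/imp_equiv_identical/identical_refl.
- by move=> G H _ _ GH X iX; apply/same_outcome_sym/GH.
- by move=> G H K _ _ _ GH HK X iX; apply: same_outcome_trans (GH X iX) (HK X iX).
- exact: impartial_dsum.
- by move=> G G' H H' _ iG' iH _; apply: imp_equiv_dsum.
- by move=> G H K _ _ _; rewrite dsumA; apply/imp_equiv_identical/identical_refl.
- by move=> G H _ _; apply/imp_equiv_identical/dsumC.
- exists (stop 0); split=> // G _; split; apply: imp_equiv_identical.
    by rewrite -{2}[G]dsumr0 dsumC.
  by rewrite dsumr0 identical_refl.
Qed.

End Games.

Theorem theorem8 (R : realType) :
  comm_monoid_upto (fun G : game R => impartial G) (@imp_equiv R) (@dsum R) /\
  (exists i j : game R,
     identity_elt i /\ identity_elt j /\ ~~ identical i j) /\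
  identity_elt (stop (0 : R)) /\
  identity_elt (two_moves R).
Proof.
split; first exact: impartial_monoid.
have [i0 i2] := (identity_stop0 R, identity_two_moves R).
split=> //; exists (stop 0), (two_moves R); do 2!split=> //.
(* The scores agree, but [stop 0] has no option to match that of [two_moves]. *)
by rewrite /= andbF.
Qed.
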